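(* For integers $n,p,k\ge1$, let $N_n(p,k)$ be the number of compositions $\alpha\in\mathcal C_n$ satisfying $P(\alpha)=p$ and $K(\alpha)=k$. Then $$N_n(p,k)=t_{n-pk}-t_{n-p(k+1)}.$$
   Context: $\mathcal C_n$ is the set of integer compositions of $n$, i.e. ordered sequences $\alpha=(a_1,\ldots,a_\ell)$ of integers $a_i\ge1$ with sum $n$. The initial run of $\alpha$ is the maximal prefix $(a_1,\ldots,a_k)$ whose entries are all equal; $P(\alpha)=a_1$ and $K(\alpha)=k$ is the number of parts in it. For an integer $m$, $t_m=0$ if $m<0$, $t_0=1$, and $t_m=2^{m-1}$ if $m\ge1$. *)

(* Defs.v *)
From HB Require Import structures.
From mathcomp Require Import all_boot all_order all_algebra.

Set Implicit Arguments.
Unset Strict Implicit.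
Unset Printing Implicit Defensive.

Import Order.TTheory GRing.Theory Num.Theory.

Definition is_composition (n : nat) (s : seq nat) : bool :=
  all (fun a => 0 < a)%N s && (sumn s == n).

Record composition (n : nat) := Composition {
  parts :> seq nat;
  _ : is_composition n parts
}.

HB.instance Definition _ n := [isSub for @parts n].
HB.instance Definition _ n := [Countable of composition n by <:].

(* Finiteness: a composition of n has at most n parts, each at most n, so it
   embeds into the sequences over 'I_n.+1 of length at most n. *)
Section Finiteness.

Variable n : nat.

Lemma size_composition (s : seq nat) : is_composition n s -> (size s <= n)%N.
Proof.
case/andP=> + /eqP <-.
elim: s => //= a s IHs /andP[a_gt0 /IHs le_s].
by rewrite -add1n leq_add.
Qed.

Lemma composition_le (s : seq nat) a :
  is_composition n s -> a \in s -> (a <= n)%N.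
Proof.
case/andP=> _ /eqP <-.
elim: s => //= b s IHs; rewrite inE => /orP[/eqP-> | /IHs le_a].
  exact: leq_addr.
exact: leq_trans le_a (leq_addl _ _).
Qed.

Definition to_bseq (c : composition n) : {bseq n of 'I_n.+1} :=
  insub_bseq n (map inord c).

Definition of_bseq (b : {bseq n of 'I_n.+1}) : option (composition n) :=
  insub (map val b).

Lemma to_bseqK : pcancel to_bseq of_bseq.
Proof.
move=> c; rewrite /of_bseq /to_bseq.
have c_ok : is_composition n c := valP c.
have sz_c : (size (map (@inord n) c) <= n)%N.
  by rewrite size_map size_composition.
rewrite insubdK // -map_comp (_ : map _ _ = val c) ?valK //.
rewrite -[RHS]map_id; apply/eq_in_map => a /(composition_le c_ok) le_a /=.
by rewrite inordK.
Qed.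

HB.instance Definition _ : isFinite (composition n) := PCanIsFinite to_bseqK.

End Finiteness.

(* The maximal prefix of s whose entries are all equal. *)
Definition initial_run (s : seq nat) : seq nat :=
  take (\max_(j < (size s).+1 | constant (take j s)) j) s.

(* The default 0 is only reached by the empty composition (of 0). *)
Definition run_part (s : seq nat) : nat := head 0%N s.

Definition run_length (s : seq nat) : nat := size (initial_run s).

Definition run_count (n p k : nat) : nat :=
  #|[set c : composition n | (run_part c == p) && (run_length c == k)]|.

Definition t (m : int) : int :=
  (if m < 0 then 0 else if m == 0 then 1 else 2 ^+ `|m|.-1)%R.

(* Main.v *)
Require Import Defs.
From HB Require Import structures.
From mathcomp Require Import all_boot all_order all_algebra.
Import Order.TTheory GRing.Theory Num.Theory.
Local Open Scope ring_scope.

(** For [j > 0], a composition starts with a run of at least [j] copies of [p]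
    exactly when it has [nseq j p] as a prefix ([prefix_nseq_run]).  Hence
    [run_count n p k] is the number of compositions of [n] with the prefix
    [nseq k p], minus the number of those with the longer prefix
    [nseq k.+1 p].  Stripping the prefix [nseq j p] leaves an arbitrary
    composition of [n - p * j], or nothing if [n < p * j]
    ([card_prefix_nseq]).  There are [2 ^ m] compositions of [m.+1]
    ([card_compositionS]), because the number doubles with each unit: a
    composition of [m.+2] arises from one of [m.+1] either by putting a new
    part 1 in front or by adding 1 to its first part, according to whether it
    starts with 1. *)

Section Counting.
Set Implicit Arguments.
Unset Strict Implicit.
Local Open Scope nat_scope.

(** Counting through the underlying sequences, so that a bijection only has to
    be given as a map into [seq nat], without dependent proofs. *)
Lemma card_composition_param (n : nat) (T : finType) (f : T -> seq nat)
    (P : pred (seq nat)) :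
    injective f ->
    (forall s, reflect (exists x, s = f x) (is_composition n s && P s)) ->
  #|[set c : composition n | P c]| = #|T|.
Proof.
move=> f_inj fP; rewrite !cardE -(size_map (@parts n)) -(size_map f).
apply/perm_size/uniq_perm.
- by rewrite map_inj_uniq ?enum_uniq //; apply: val_inj.
- by rewrite map_inj_uniq ?enum_uniq.
move=> s; apply/mapP/mapP => [[c] | [x _ s_def]].
  rewrite mem_enum inE => Pc ->.
  have /fP[x ->] : is_composition n c && P c by rewrite Pc (valP c).
  by exists x; rewrite ?mem_enum.
have /andP[s_comp Ps] : is_composition n s && P s by apply/fP; exists x.
by exists (Composition s_comp); rewrite ?mem_enum ?inE.
Qed.

Lemma card_composition0 : #|{: composition 0}| = 1.
Proof.
rewrite -cardsT -[RHS]card_unit.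
apply: (@card_composition_param 0 _ (fun _ : unit => [::]) predT).
  by move=> x y; case: x; case: y.
move=> s; rewrite andbT; apply: (iffP idP) => [|[_ ->] //].
by move/size_composition; case: s => // _; exists tt.
Qed.

Lemma card_composition1 : #|{: composition 1}| = 1.
Proof.
rewrite -cardsT -[RHS]card_unit.
apply: (@card_composition_param 1 _ (fun _ : unit => [:: 1]) predT).
  by move=> x y; case: x; case: y.
move=> s; rewrite andbT; apply: (iffP idP) => [|[_ ->] //].
by case: s => [|[|[|a]] [|[|b] s]] //; rewrite /is_composition /= ?andbF //; exists tt.
Qed.

Definition incr_head (s : seq nat) : seq nat := (head 0 s).+1 :: behead s.

Lemma card_compositionSS m :
  #|{: composition m.+2}| = 2 * #|{: composition m.+1}|.
Proof.
rewrite -cardsT -card_bool -card_prod.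
pose f (x : bool * composition m.+1) : seq nat :=
  if x.1 then 1 :: x.2 else incr_head x.2.
apply: (@card_composition_param m.+2 _ f predT).
  move=> [b1 [s1 c1]] [b2 [s2 c2]]; rewrite /f /incr_head.
  (* The parts being positive, an incremented head is never 1. *)
  case: b1 b2 s1 c1 s2 c2 => [] [] [|[|a1] s1] c1 [|[|a2] s2] c2 //= [].
  - by move=> e1 e2; congr (_, _); apply: val_inj; rewrite /= e1 e2.
  - by move=> e1 e2; congr (_, _); apply: val_inj; rewrite /= e1 e2.
move=> s; rewrite andbT; apply: (iffP idP) => [|[[b [s1 c1]] ->]].
  case: s => [|[|[|a]] s] // s_comp.
    have s_comp' : is_composition m.+1 s by [].
    by exists (true, Composition s_comp').
  have s_comp' : is_composition m.+1 (a.+1 :: s) by [].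
  by exists (false, Composition s_comp').
by rewrite /f /incr_head; case: b s1 c1 => [] [|[|a] s1] c1 //; apply: c1.
Qed.

Lemma card_compositionS m : #|{: composition m.+1}| = 2 ^ m.
Proof.
by elim: m => [|m IHm]; rewrite ?card_composition1 // card_compositionSS IHm expnS.
Qed.

(** The lengths of the constant prefixes are closed downwards, so that their
    maximum [run_length s] bounds precisely these lengths. *)
Lemma leq_run_length (s : seq nat) j :
  (j <= run_length s) = (j <= size s) && constant (take j s).
Proof.
have run_max : run_length s = \max_(i < (size s).+1 | constant (take i s)) i.
  by rewrite /run_length size_takel //; apply/bigmax_leqP => i _; rewrite -ltnS.
rewrite run_max; apply/idP/andP => [|[le_js j_const]]; last first.
  have lt_js : j < (size s).+1 by [].
  exact: (@leq_bigmax_cond _ _ (fun i : 'I_(size s).+1 => i : nat)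
                           (Ordinal lt_js)).
have [|i i_const ->] := @eq_bigmax_cond _
    [pred i : 'I_(size s).+1 | constant (take i s)] (fun i => i : nat).
  by apply/card_gt0P; exists ord0; rewrite inE take0.
move=> le_ji; split; first by rewrite (leq_trans le_ji) // -ltnS.
rewrite -(take_takel s le_ji); move: i_const; rewrite inE.
case: (take i s) => [|x r] //; case: j {le_ji} => [|j] //=.
by move=> /allP r_const; apply/allP => y /mem_take /r_const.
Qed.

Lemma prefix_nseq_run p j (s : seq nat) :
  prefix (nseq j.+1 p) s = (run_part s == p) && (j < run_length s).
Proof.
rewrite leq_run_length prefixE size_nseq.
case: s => [|a s] /=; first by rewrite andbF.
rewrite eqseq_cons ltnS; case: eqP => //= ->.
apply/eqP/andP => [s_def | [le_js /all_pred1P->]]; last by rewrite size_takel.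
split; last by rewrite s_def; apply/all_pred1P; rewrite size_nseq.
by have /(congr1 size) := s_def; rewrite size_nseq size_take_min => /minn_idPl.
Qed.

Lemma is_composition_nseq_cat n p j s : 0 < p ->
  is_composition n (nseq j p ++ s) =
    (p * j <= n) && is_composition (n - p * j) s.
Proof.
move=> p_gt0; rewrite /is_composition all_cat all_nseq p_gt0 orbT /= sumn_cat.
rewrite sumn_nseq andbCA; congr (_ && _).
have [le_n | lt_n] := leqP (p * j) n.
  by rewrite -[RHS](eqn_add2l (p * j)) subnKC.
by apply/negbTE; rewrite gtn_eqF // ltn_addr.
Qed.

Lemma card_prefix_nseq n p j : 0 < p ->
  #|[set c : composition n | prefix (nseq j p) c]| =
    if p * j <= n then #|{: composition (n - p * j)}| else 0.
Proof.
move=> p_gt0; have [le_n | lt_n] := leqP (p * j) n; last first.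
  apply: eq_card0 => c; rewrite inE; apply/negP => /prefixP[s c_def].
  have : is_composition n c := valP c.
  by rewrite c_def is_composition_nseq_cat // leqNgt lt_n.
apply: (@card_composition_param n _
  (fun c : composition (n - p * j) => nseq j p ++ c)).
  by move=> c1 c2 /eqP; rewrite eqseq_cat // eqxx => /eqP/val_inj.
move=> s; apply: (iffP andP) => [[s_comp /prefixP[r s_def]] | [c ->]].
  move: s_comp; rewrite s_def is_composition_nseq_cat // le_n => r_comp.
  by exists (Composition r_comp).
by rewrite is_composition_nseq_cat // le_n prefix_prefix; split=> //; apply: valP.
Qed.

End Counting.

(** The value 0 of [t] at negative arguments matches the absence of
    compositions of [n] with a prefix of sum greater than [n]. *)
Lemma card_prefix_nseq_t (n p j : nat) : (0 < p)%N ->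
  #|[set c : composition n | prefix (nseq j p) c]|%:Z =
    t (n%:Z - p%:Z * j%:Z).
Proof.
move=> p_gt0; rewrite card_prefix_nseq // /t -PoszM subr_lt0 ltz_nat.
have [le_n | lt_n] := leqP (p * j)%N n; last by [].
rewrite subzn //; case: (n - p * j)%N => [|m].
  by rewrite card_composition0.
by rewrite card_compositionS /= -natz natrX.
Qed.

Theorem theorem4p1 (n p k : nat)
    (hn : (0 < n)%N) (hp : (0 < p)%N) (hk : (0 < k)%N) :
  (run_count n p k)%:Z =
    t (n%:Z - p%:Z * k%:Z) - t (n%:Z - p%:Z * (k%:Z + 1)).
Proof.
case: k hk => // k _.
have -> : k.+1%:Z + 1 = k.+2%:Z by rewrite -[in RHS]addn1 PoszD.
rewrite -!card_prefix_nseq_t // /run_count.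
set A := [set c : composition n | prefix (nseq k.+1 p) c].
set B := [set c : composition n | prefix (nseq k.+2 p) c].
have sBA : B \subset A.
  apply/subsetP => c; rewrite !inE !prefix_nseq_run => /andP[-> /=].
  exact: ltnW.
rewrite subzn ?subset_leq_card // -cardsDS //; congr (Posz _).
apply: eq_card => c; rewrite !inE !prefix_nseq_run.
by case: eqP => //= _; rewrite -leqNgt eqn_leq.
Qed.
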